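(* Let $\mathsf{DL}$ be the category of bounded distributive lattices and lattice homomorphisms, and $\mathsf{Pri}$ the category of Priestley spaces and continuous monotone maps, and let $\mathbbm{2}^-:\mathsf{Pri}\to\mathsf{DL}^{\mathrm{op}}$, $\mathbbm{2}^-:\mathsf{DL}^{\mathrm{op}}\to\mathsf{Pri}$ be the Priestley duality (homming into $\mathbbm{2}=\{0<1\}$). Define $\overline{\mathbbm{2}}$ on a $\mathsf{Pri}$-relation $r\subseteq X\times Y$ by $$\overline{\mathbbm{2}}(r)=\{(a,b)\in \mathbbm{2}^X\times\mathbbm{2}^Y \mid \forall (x,y)\in r.\ (x\in a\Rightarrow y\in b)\},$$ where $\mathbbm{2}^X$ is the distributive lattice of clopen up-sets of $X$ (equivalently, $(a,b)\in\overline{\mathbbm{2}}(r)$ iff $a\circ p\le b\circ q$ where $X\xleftarrow{p} r\xrightarrow{q}Y$ are the projections), and on a $\mathsf{DL}$-relation $R\subseteq A\times B$ by $$\overline{\mathbbm{2}}(R)=\{(x,y)\in \mathbbm{2}^A\times\mathbbm{2}^B \mid \forall (a,b)\in R.\ (a\in x\Rightarrow b\in y)\},$$ where $\mathbbm{2}^A$ is the Priestley space of prime filters of $A$ (lattice homomorphisms $A\to\mathbbm{2}$). Then these assignments (identity on objects) are well-defined functors $\overline{\mathbbm{2}}:\mathsf{Rel}(\mathsf{Pri})^{\mathrm{co}}\to\mathsf{Rel}(\mathsf{DL})$ and $\overline{\mathbbm{2}}:\mathsf{Rel}(\mathsf{DL})\to\mathsf{Rel}(\mathsf{Pri})^{\mathrm{co}}$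 which extend the Priestley duality, in the sense that $\overline{\mathbbm{2}}(f_\ast)=(\mathbbm{2}^f)^\ast$ for every $\mathsf{Pri}$-map $f$ and $\overline{\mathbbm{2}}(g^\ast)=(\mathbbm{2}^g)_\ast$ for every $\mathsf{DL}$-map $g$, and they form an equivalence of categories between $\mathsf{Rel}(\mathsf{Pri})^{\mathrm{co}}$ and $\mathsf{Rel}(\mathsf{DL})$.
   Context: For posets $A,B$, a weakening (monotone) relation $R:A\looparrowright B$ is a subset $R\subseteq A\times B$ with $a'\le a\,R\,b\le b'\Rightarrow a'Rb'$ (i.e. a monotone map $A^{\mathrm{op}}\times B\to\mathbbm{2}$). Composition $S\cdot R$ (also written $R;S$) is ordinary relational composition ($R$ first); the identity on $A$ is the order $\le_A$. For a monotone map $f:A\to B$, $f_\ast:A\looparrowright B$ is $\{(a,b)\mid f(a)\le b\}$ and $f^\ast:B\looparrowright A$ is $\{(b,a)\mid b\le f(a)\}$. A $\mathsf{DL}$-relation $R:A\looparrowright B$ between bounded distributive lattices is a weakening relation (w.r.t. the lattice orders) which is a bounded sublattice of $A\times B$ (contains $(0,0),(1,1)$, closed under componentwise $\wedge,\vee$). A $\mathsf{Pri}$-relation $X\looparrowright Y$ between Priestley spaces is an upward closed subset of $X^{\mathrm{op}}\times Y$ which is a subspace in $\mathsf{Pri}$ (a closed subset, with the subspace topology and order). $\mathsf{Rel}(\mathsf{DL})$ (resp. $\mathsf{Rel}(\mathsf{Pri})$) has as objects the objects of $\mathsf{DL}$ (resp. $\mathsf{Pri}$), as arrows the $\mathsf{DL}$-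 (resp. $\mathsf{Pri}$-) relations, composition and identities as for weakening relations, and homsets ordered by inclusion; $(-)^{\mathrm{co}}$ denotes reversing the order on homsets. The functors $\overline{\mathbbm{2}}$ are thus covariant on relations and reverse inclusion. *)

(* Defs.v *)
From HB Require Import structures.
From mathcomp Require Import all_boot all_order.
From mathcomp Require Import finmap all_classical.
From mathcomp Require Import topology.

Set Implicit Arguments.
Unset Strict Implicit.
Unset Printing Implicit Defensive.

Import Order.TTheory.

Local Open Scope classical_set_scope.
Local Open Scope order_scope.

(* [Order.TBLatticeMorphism] only asks for the preservation of the bounds. *)
#[short(type="dlMorphism")]
HB.structure Definition DLMorphism d (A : tbDistrLatticeType d)
    d' (B : tbDistrLatticeType d') :=
  {f of @Order.LatticeMorphism d A d' B f & @Order.TBLatticeMorphism d A d' B f}.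

Definition up_closed d (X : porderType d) (U : set X) : Prop :=
  forall x y, x <= y -> U x -> U y.

HB.mixin Record isPriestley d X & Topological X & Order.POrder d X := {
  priestley_compact : compact [set: X];
  priestley_separation : forall x y : X, ~ x <= y ->
    exists U : set X, [/\ clopen U, up_closed U, U x & ~ U y]
}.

#[short(type="priestleyType")]
HB.structure Definition Priestley d :=
  {X of isPriestley d X & Topological X & Order.POrder d X}.

#[short(type="priMorphism")]
HB.structure Definition PriMorphism d (X : priestleyType d)
    d' (Y : priestleyType d') :=
  {f of @Continuous X Y f & @Order.OrderMorphism d X d' Y f}.

Section ClopenUpsets.
Context {d : Order.disp_t} {X : priestleyType d}.

Definition clopen_upset : pred (set X) :=
  fun a => `[< clopen a /\ up_closed a >].

Record clopenUpset := ClopenUpset {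
  clopenUpset_set :> set X;
  clopenUpset_subproof : clopen_upset clopenUpset_set
}.

HB.instance Definition _ := [isSub for clopenUpset_set].
HB.instance Definition _ := [Choice of clopenUpset by <:].

Fact clopen_upset_tbLattice_closed :
  [/\ {in clopen_upset &, forall a b, a `&` b \in clopen_upset},
      {in clopen_upset &, forall a b, a `|` b \in clopen_upset},
      \bot \in clopen_upset & \top \in clopen_upset].
Proof.
split=> [a b|a b||]; rewrite ?unfold_in.
- move=> /asboolP[ca ua] /asboolP[cb ub]; apply/asboolP; split.
    exact: clopenI.
  by move=> x y xy [ax bx]; split; [exact: ua ax|exact: ub bx].
- move=> /asboolP[ca ua] /asboolP[cb ub]; apply/asboolP; split.
    exact: clopenU.
  by move=> x y xy [ax|bx]; [left; exact: ua ax|right; exact: ub bx].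
- by apply/asboolP; split; [exact: clopen0|move=> x y _ []].
- by apply/asboolP; split; [exact: clopenT|move=> x y _ _].
Qed.

HB.instance Definition _ := Order.SubChoice_isTBSubLattice.Build
  _ _ _ set_display clopenUpset
  (let: And4 h _ _ _ := clopen_upset_tbLattice_closed in h)
  (let: And4 _ h _ _ := clopen_upset_tbLattice_closed in h)
  (let: And4 _ _ h _ := clopen_upset_tbLattice_closed in h)
  (let: And4 _ _ _ h := clopen_upset_tbLattice_closed in h).

Fact clopenUpset_meetUl :
  @left_distributive clopenUpset clopenUpset Order.meet Order.join.
Proof.
move=> a b c; apply: val_inj.
exact: (@meetUl _ (set X) (val a) (val b) (val c)).
Qed.

HB.instance Definition _ :=
  Order.Lattice_Meet_isDistrLattice.Build set_display clopenUpset
    clopenUpset_meetUl.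

End ClopenUpsets.
Arguments clopenUpset {d} X.

Section PrimeFilters.
Context {d : Order.disp_t} {A : tbDistrLatticeType d}.

Definition prime_filter : pred (set A) := fun x =>
  `[< [/\ x \top, ~ x \bot, up_closed x,
          forall a b, x a -> x b -> x (a `&` b)
        & forall a b, x (a `|` b) -> x a \/ x b] >].

Record primeFilter := PrimeFilter {
  primeFilter_set :> set A;
  primeFilter_subproof : prime_filter primeFilter_set
}.

HB.instance Definition _ := [isSub for primeFilter_set].
HB.instance Definition _ := [Choice of primeFilter by <:].
HB.instance Definition _ :=
  [SubChoice_isSubPOrder of primeFilter by <: with set_display].

Definition basic_upset (a : A) : set primeFilter := [set x | (x : set A) a].

Definition primeFilter_subbase : set (set primeFilter) :=
  [set U | exists a, U = basic_upset a \/ U = (~` basic_upset a)%classic].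

HB.instance Definition _ := isSubBaseTopological.Build primeFilter
  primeFilter_subbase id.

Lemma primeFilterP (x : primeFilter) :
  [/\ (x : set A) \top, ~ (x : set A) \bot, up_closed x,
      forall a b, (x : set A) a -> (x : set A) b -> (x : set A) (a `&` b)
    & forall a b, (x : set A) (a `|` b) -> (x : set A) a \/ (x : set A) b].
Proof. by case: x => x /= /asboolP. Qed.

Lemma primeFilter_leP (x y : primeFilter) :
  reflect ((x : set A) `<=` (y : set A))%classic (x <= y).
Proof. by rewrite -Order.le_val; exact: subsetPset. Qed.

Lemma open_primeFilter_subbase (U : set primeFilter) :
  primeFilter_subbase U -> open U.
Proof.
move=> subU; exists [set U]; last by rewrite bigcup_set1.
move=> _ ->; exists [fset U]%fset; last by rewrite set_fset1 bigcap_set1.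
by move=> V; rewrite in_fset1 => /eqP ->; exact/mem_set.
Qed.

Lemma primeFilter_cvg (F : set_system primeFilter) (x : primeFilter) :
  Filter F ->
  (forall U, primeFilter_subbase U -> U x -> F U) -> F --> x.
Proof.
move=> FF Fsub V; rewrite nbhsE => -[W [[D Dsub <-] [U DU Ux]] WV].
apply: (filterS WV); apply: (@filterS _ _ _ U) => [y Uy|]; first by exists U.
have [E Esub EU] := Dsub _ DU; move: Ux; rewrite -EU => Ux.
apply: filter_bigI => // i iE; apply: Fsub; last exact: Ux.
by have /set_mem := Esub _ iE.
Qed.

Lemma basic_upset_clopen a : clopen (basic_upset a).
Proof.
split; first by apply: open_primeFilter_subbase; exists a; left.
rewrite -openC; apply: open_primeFilter_subbase; exists a; by right.
Qed.

Fact primeFilter_compact : compact [set: primeFilter].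
Proof.
rewrite compact_ultra => F FU _.
pose x0 : set A := [set a | F (basic_upset a)].
have x0P : prime_filter x0.
  apply/asboolP; split.
  - rewrite /x0/=; suff -> : basic_upset \top = setT by exact: filterT.
    by apply/seteqP; split=> // y _; have [] := primeFilterP y.
  - rewrite /x0/=; suff -> : basic_upset \bot = set0.
      exact: filter_not_empty.
    by apply/seteqP; split=> // y; have [] := primeFilterP y.
  - move=> a b ab; apply: filterS => y ya.
    by have [_ _ up _ _] := primeFilterP y; exact: up ab ya.
  - move=> a b xa xb; apply: filterS (filterI xa xb) => y [ya yb].
    by have [_ _ _ meet _] := primeFilterP y; exact: meet.
  - move=> a b xab.
    have [xa|nxa] := pselect (x0 a); first by left.
    right; have [//|Fna] := in_ultra_setVsetC (basic_upset a) FU.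
    apply: filterS (filterI xab Fna) => y [yab /= nya].
    by have [_ _ _ _ prime] := primeFilterP y; case: (prime _ _ yab).
exists (PrimeFilter x0P); split => //.
apply: primeFilter_cvg => U [a [->|->]] //= nxa.
by have [//|//] := in_ultra_setVsetC (basic_upset a) FU.
Qed.

Fact primeFilter_separation (x y : primeFilter) : ~ x <= y ->
  exists U : set primeFilter, [/\ clopen U, up_closed U, U x & ~ U y].
Proof.
move=> nle.
have /existsNP[a /not_implyP[xa nya]] : ~ ((x : set A) `<=` y)%classic.
  by move/primeFilter_leP.
exists (basic_upset a); split=> //; first exact: basic_upset_clopen.
by move=> z t /primeFilter_leP zt; exact: zt.
Qed.

HB.instance Definition _ := isPriestley.Build set_display primeFilter
  primeFilter_compact primeFilter_separation.

End PrimeFilters.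
Arguments primeFilter {d} A.

Section DualOfPriMorphism.
Context {d d' : Order.disp_t} {X : priestleyType d} {Y : priestleyType d'}.
Variable f : priMorphism X Y.

Fact dualPri_subproof (b : clopenUpset Y) : clopen_upset (f @^-1` b)%classic.
Proof.
case: b => b /= /asboolP[cb ub]; apply/asboolP; split.
  by apply: preimage_clopen => //; exact: cts_fun.
by move=> x y xy; apply: ub; exact: Order.omorph_le_subproof.
Qed.

Definition dualPri (b : clopenUpset Y) : clopenUpset X :=
  ClopenUpset (dualPri_subproof b).

Fact dualPri_le : {homo dualPri : a b / a <= b}.
Proof.
by move=> a b; rewrite -!Order.le_val => /subsetPset ab; apply/subsetPset => x /ab.
Qed.
HB.instance Definition _ := Order.isOrderMorphism.Build _ _ _ _ dualPri dualPri_le.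

Fact dualPri_meet : {morph dualPri : a b / a `&` b}.
Proof. by move=> a b; exact: val_inj. Qed.
Fact dualPri_join : {morph dualPri : a b / a `|` b}.
Proof. by move=> a b; exact: val_inj. Qed.
HB.instance Definition _ := Order.isLatticeMorphism.Build _ _ _ _ dualPri
  dualPri_meet dualPri_join.

Fact dualPri_bot : dualPri \bot = \bot.
Proof. exact: val_inj. Qed.
Fact dualPri_top : dualPri \top = \top.
Proof. exact: val_inj. Qed.
HB.instance Definition _ := Order.isBLatticeMorphism.Build _ _ _ _ dualPri
  dualPri_bot.
HB.instance Definition _ := Order.isTLatticeMorphism.Build _ _ _ _ dualPri
  dualPri_top.

End DualOfPriMorphism.

Section DualOfDLMorphism.
Context {d d' : Order.disp_t}.
Context {A : tbDistrLatticeType d} {B : tbDistrLatticeType d'}.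
Variable g : dlMorphism A B.

Fact dualDL_subproof (x : primeFilter B) : prime_filter (g @^-1` x)%classic.
Proof.
have [x1 x0 up meet prime] := primeFilterP x; apply/asboolP; split=> /=.
- by rewrite omorph1.
- by rewrite omorph0.
- by move=> a b ab; apply: up; exact: omorph_le.
- by move=> a b xa xb; rewrite omorphI; exact: meet.
- by move=> a b; rewrite omorphU; exact: prime.
Qed.

Definition dualDL (x : primeFilter B) : primeFilter A :=
  PrimeFilter (dualDL_subproof x).

Fact dualDL_continuous : continuous dualDL.
Proof.
move=> x; apply: primeFilter_cvg => [|U [a [->|->]] Ux].
- exact: (@fmap_filter _ _ dualDL _ (nbhs_filter x)).
- by apply: open_nbhs_nbhs; split=> //; exact: (basic_upset_clopen (g a)).1.
- apply: open_nbhs_nbhs; split=> //.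
  by apply: (open_primeFilter_subbase (U := ~` basic_upset (g a))%classic); exists (g a); right.
Qed.
HB.instance Definition _ := isContinuous.Build _ _ dualDL dualDL_continuous.

Fact dualDL_le : {homo dualDL : x y / x <= y}.
Proof. by move=> x y /primeFilter_leP xy; apply/primeFilter_leP => a /xy. Qed.
HB.instance Definition _ := Order.isOrderMorphism.Build _ _ _ _ dualDL dualDL_le.

End DualOfDLMorphism.

Section Weakening.
Context {d d' : Order.disp_t} {A : porderType d} {B : porderType d'}.

Definition weakening (R : set (A * B)) : Prop :=
  forall a' a b b', a' <= a -> R (a, b) -> b <= b' -> R (a', b').

Definition lower_star (f : A -> B) : set (A * B) := [set ab | f ab.1 <= ab.2].

Definition upper_star (f : A -> B) : set (B * A) := [set ba | ba.1 <= f ba.2].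

End Weakening.

Definition rel_id {d} {A : porderType d} : set (A * A) :=
  [set ab | ab.1 <= ab.2].

Definition rel_comp {A B C : Type} (R : set (A * B)) (S : set (B * C)) :
    set (A * C) :=
  [set ac | exists2 b, R (ac.1, b) & S (b, ac.2)].

Lemma rel_compA {A B C D : Type}
    (R : set (A * B)) (S : set (B * C)) (T : set (C * D)) :
  rel_comp R (rel_comp S T) = rel_comp (rel_comp R S) T.
Proof.
apply/seteqP; split=> -[a e] /=.
  by move=> [b Rab [c Sbc Tce]]; exists c => //; exists b.
by move=> [c [b Rab Sbc] Tce]; exists b => //; exists c.
Qed.

Lemma rel_compS {A B C : Type} (R R' : set (A * B)) (S S' : set (B * C)) :
  (R `<=` R' -> S `<=` S' -> rel_comp R S `<=` rel_comp R' S')%classic.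
Proof. by move=> RR' SS' [a c] [b Rab Sbc]; exists b; [exact: RR'|exact: SS']. Qed.

Section WeakeningTheory.
Context {d d' : Order.disp_t} {A : porderType d} {B : porderType d'}.
Variable R : set (A * B).
Hypothesis wR : weakening R.

Lemma rel_comp1r : rel_comp rel_id R = R.
Proof.
apply/seteqP; split=> -[a b] /=; last first.
  by move=> Rab; exists a => //; exact: lexx.
by move=> [a' aa' Ra'b]; exact: wR aa' Ra'b (lexx _).
Qed.

Lemma rel_compr1 : rel_comp R rel_id = R.
Proof.
apply/seteqP; split=> -[a b] /=; last first.
  by move=> Rab; exists b => //; exact: lexx.
by move=> [b' Rab' b'b]; exact: wR (lexx _) Rab' b'b.
Qed.

End WeakeningTheory.

Lemma weakening_comp d d' d'' (A : porderType d) (B : porderType d')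
    (C : porderType d'') (R : set (A * B)) (S : set (B * C)) :
  weakening R -> weakening S -> weakening (rel_comp R S).
Proof.
move=> wR wS a' a c c' a'a [b Rab Sbc] cc'; exists b => /=.
  exact: wR a'a Rab (lexx _).
exact: wS (lexx _) Sbc cc'.
Qed.

Lemma weakening_id d (A : porderType d) : weakening (@rel_id d A).
Proof. by move=> a' a b b' aa' ab bb'; exact: le_trans aa' (le_trans ab bb'). Qed.

Section DLRelations.
Context {d d' : Order.disp_t}.
Context {A : tbDistrLatticeType d} {B : tbDistrLatticeType d'}.

Definition is_DLrel (R : set (A * B)) : Prop :=
  [/\ weakening R,
      R (\bot, \bot),
      R (\top, \top),
      forall a b a' b', R (a, b) -> R (a', b') -> R (a `&` a', b `&` b')
    & forall a b a' b', R (a, b) -> R (a', b') -> R (a `|` a', b `|` b')].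

Record DLrel := DLRel { DLrel_set :> set (A * B); DLrelP : is_DLrel DLrel_set }.

Lemma DLrel_inj (R S : DLrel) : (R : set (A * B)) = S -> R = S.
Proof.
by case: R S => [R Rp] [S Sp] /= E; subst S; congr DLRel; exact: Prop_irrelevance.
Qed.

End DLRelations.
Arguments DLrel {d d'} A B.

Section PriRelations.
Context {d d' : Order.disp_t} {X : priestleyType d} {Y : priestleyType d'}.

Definition is_Prirel (r : set (X * Y)) : Prop := weakening r /\ closed r.

Record Prirel :=
  PriRel { Prirel_set :> set (X * Y); PrirelP : is_Prirel Prirel_set }.

Lemma Prirel_inj (r s : Prirel) : (r : set (X * Y)) = s -> r = s.
Proof.
by case: r s => [r rp] [s sp] /= E; subst s; congr PriRel; exact: Prop_irrelevance.
Qed.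

End PriRelations.
Arguments Prirel {d d'} X Y.

Lemma is_DLrel_id d (A : tbDistrLatticeType d) : is_DLrel (@rel_id d A).
Proof.
split.
- exact: weakening_id.
- exact: lexx.
- exact: lexx.
- by move=> a b a' b'; exact: leI2.
- by move=> a b a' b'; exact: leU2.
Qed.

Lemma is_DLrel_comp d d' d'' (A : tbDistrLatticeType d)
    (B : tbDistrLatticeType d') (C : tbDistrLatticeType d'')
    (R : set (A * B)) (S : set (B * C)) :
  is_DLrel R -> is_DLrel S -> is_DLrel (rel_comp R S).
Proof.
move=> [wR R0 R1 RI RU] [wS S0 S1 SI SU]; split.
- exact: weakening_comp.
- by exists \bot.
- by exists \top.
- move=> a c a' c' [b Rab Sbc] [b' Rab' Sbc'].
  by exists (b `&` b'); [exact: RI|exact: SI].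
- move=> a c a' c' [b Rab Sbc] [b' Rab' Sbc'].
  by exists (b `|` b'); [exact: RU|exact: SU].
Qed.

Lemma is_DLrel_upper_star d d' (A : tbDistrLatticeType d)
    (B : tbDistrLatticeType d') (g : dlMorphism A B) :
  is_DLrel (upper_star g).
Proof.
split.
- move=> b' b a a' b'b ba aa'; apply: le_trans b'b (le_trans ba _).
  exact: omorph_le.
- exact: le0x.
- by rewrite /upper_star/= omorph1.
- by move=> a b a' b'; rewrite /upper_star/= omorphI; exact: leI2.
- by move=> a b a' b'; rewrite /upper_star/= omorphU; exact: leU2.
Qed.

Lemma is_Prirel_lower_star d d' (X : priestleyType d) (Y : priestleyType d')
    (f : priMorphism X Y) :
  is_Prirel (lower_star f).
Proof.
split.
  move=> x' x y y' x'x xy yy'; apply: le_trans (le_trans xy yy').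
  exact: omorph_le.
rewrite -openC openE => -[x y] /= nxy.
have [U [[oU cU] uU Ux Uy]] := priestley_separation _ _ nxy.
exists (f @^-1` U, ~` U)%classic; first split => /=.
- apply: (cts_fun (s := f)); exact: open_nbhs_nbhs.
- by apply: open_nbhs_nbhs; split=> //; exact: closed_openC.
by move=> [x' y'] [/= Ux' nUy'] xy'; apply: nUy'; exact: uU xy' Ux'.
Qed.

Lemma is_Prirel_id d (X : priestleyType d) : is_Prirel (@rel_id d X).
Proof.
split; first exact: weakening_id.
rewrite -openC openE => -[x y] /= nxy.
have [U [[oU cU] uU Ux Uy]] := priestley_separation _ _ nxy.
exists (U, ~` U)%classic; first split => /=.
- exact: open_nbhs_nbhs.
- by apply: open_nbhs_nbhs; split=> //; exact: closed_openC.
by move=> [x' y'] [/= Ux' nUy'] xy'; apply: nUy'; exact: uU xy' Ux'.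
Qed.

Lemma is_Prirel_comp d d' d'' (X : priestleyType d) (Y : priestleyType d')
    (Z : priestleyType d'') (r : set (X * Y)) (s : set (Y * Z)) :
  is_Prirel r -> is_Prirel s -> is_Prirel (rel_comp r s).
Proof.
move=> [wr cr] [ws cs]; split; first exact: weakening_comp.
rewrite -openC openE => -[x z] /= nxz.
have /compact_near_coveringP cY := @priestley_compact _ Y.
pose P (xz : X * Z) y := ~ (r (xz.1, y) /\ s (y, xz.2)).
have : \forall xz \near (x, z), ([set: Y] `<=` P xz)%classic.
  apply: (cY _ (nbhs (x, z)) P (nbhs_filter _)) => y _.
  have [rxy|nrxy] := pselect (r (x, y)).
    have : nbhs (y, z) (~` s)%classic.
      apply: open_nbhs_nbhs; split; first exact: closed_openC.
      by move=> syz; apply: nxz; exists y.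
    move=> [[V W] [/= yV zW] VW]; exists (V, setT `*` W)%classic.
      split=> //=; exists (setT, W) => //; split=> //; exact: filterT.
    by move=> [y' [x' z']] [/= Vy' [_ Wz']] [_ /=]; exact: (VW (y', z')).
  have : nbhs (x, y) (~` r)%classic.
    by apply: open_nbhs_nbhs; split=> //; exact: closed_openC.
  move=> [[U V] [/= xU yV] UV]; exists (V, U `*` setT)%classic.
    split=> //=; exists (U, setT) => //; split=> //; exact: filterT.
  by move=> [y' [x' z']] [/= Vy' [Ux' _]] [+ _ /=]; exact: (UV (x', y')).
apply: filterS => -[x' z'] xzP [y rxy syz]; exact: (xzP y).
Qed.

Definition DLrel_upper_star {d d'} {A : tbDistrLatticeType d}
    {B : tbDistrLatticeType d'} (g : dlMorphism A B) : DLrel B A :=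
  DLRel (is_DLrel_upper_star g).

Definition Prirel_lower_star {d d'} {X : priestleyType d}
    {Y : priestleyType d'} (f : priMorphism X Y) : Prirel X Y :=
  PriRel (is_Prirel_lower_star f).

(* Composition is written in diagrammatic order: [comp f g] is [f] first. *)
Record ordCat := OrdCat {
  obj :> Type;
  hom : obj -> obj -> Type;
  hom_le : forall {a b}, hom a b -> hom a b -> Prop;
  idm : forall a, hom a a;
  comp : forall {a b c}, hom a b -> hom b c -> hom a c;
  hom_le_refl : forall a b (f : hom a b), hom_le f f;
  hom_le_trans : forall a b (f g h : hom a b),
    hom_le f g -> hom_le g h -> hom_le f h;
  hom_le_anti : forall a b (f g : hom a b), hom_le f g -> hom_le g f -> f = g;
  comp_le : forall a b c (f f' : hom a b) (g g' : hom b c),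
    hom_le f f' -> hom_le g g' -> hom_le (comp f g) (comp f' g');
  comp_idl : forall a b (f : hom a b), comp (idm a) f = f;
  comp_idr : forall a b (f : hom a b), comp f (idm b) = f;
  compA : forall a b c e (f : hom a b) (g : hom b c) (h : hom c e),
    comp f (comp g h) = comp (comp f g) h
}.
Arguments hom {o} a b.
Arguments hom_le {o a b} f g.
Arguments idm {o} a.
Arguments comp {o a b c} f g.

Definition co (C : ordCat) : ordCat :=
  @OrdCat C (@hom C) (fun a b f g => hom_le g f) (@idm C) (@comp C)
    (fun a b f => hom_le_refl f)
    (fun a b f g h fg gh => hom_le_trans gh fg)
    (fun a b f g fg gf => hom_le_anti gf fg)
    (fun a b c f f' g g' ff' gg' => comp_le ff' gg')
    (@comp_idl C) (@comp_idr C) (@compA C).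

Definition is_functor (C D : ordCat) (F0 : C -> D)
    (F1 : forall a b : C, hom a b -> hom (F0 a) (F0 b)) : Prop :=
  [/\ forall a, F1 a a (idm a) = idm (F0 a),
      forall a b c (f : hom a b) (g : hom b c),
        F1 a c (comp f g) = comp (F1 a b f) (F1 b c g)
    & forall a b (f g : hom a b), hom_le f g -> hom_le (F1 a b f) (F1 a b g)].

Record functor (C D : ordCat) := Functor {
  fobj :> C -> D;
  fmap_hom : forall a b : C, hom a b -> hom (fobj a) (fobj b);
  functorP : is_functor fmap_hom
}.
Arguments fmap_hom {C D} F {a b} f : rename.

Lemma is_functor_id (C : ordCat) :
  is_functor (F0 := fun a : C => a) (fun a b (f : hom a b) => f).
Proof. by split. Qed.

Definition functor_id (C : ordCat) : functor C C := Functor (is_functor_id C).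

Lemma is_functor_comp (C D E : ordCat) (F : functor C D) (G : functor D E) :
  is_functor (F0 := fun a => G (F a))
    (fun a b (f : hom a b) => fmap_hom G (fmap_hom F f)).
Proof.
case: F G => [F0 F1 /= [Fi Fc Fl]] [G0 G1 /= [Gi Gc Gl]]; split=> /=.
- by move=> a; rewrite Fi Gi.
- by move=> a b c f g; rewrite Fc Gc.
- by move=> a b f g fg; exact/Gl/Fl.
Qed.

Definition functor_comp (C D E : ordCat) (F : functor C D) (G : functor D E) :
  functor C E := Functor (is_functor_comp F G).

Definition naturally_isomorphic (C D : ordCat) (F G : functor C D) : Prop :=
  exists (t : forall a, hom (F a) (G a)) (u : forall a, hom (G a) (F a)),
    [/\ forall a, comp (t a) (u a) = idm (F a),
        forall a, comp (u a) (t a) = idm (G a)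
      & forall a b (f : hom a b),
          comp (fmap_hom F f) (t b) = comp (t a) (fmap_hom G f)].

Definition is_equivalence (C D : ordCat) (F : functor C D) (G : functor D C) :
    Prop :=
  naturally_isomorphic (functor_id C) (functor_comp F G) /\
  naturally_isomorphic (functor_comp G F) (functor_id D).

(* The displays are notational tags of the order library, without mathematical
   content. *)
Record DLob := DLOb {
  DLob_disp : Order.disp_t;
  DLob_sort :> tbDistrLatticeType DLob_disp
}.

Record Priob := PriOb {
  Priob_disp : Order.disp_t;
  Priob_sort :> priestleyType Priob_disp
}.

Definition DLrel_id (A : DLob) : DLrel A A := DLRel (is_DLrel_id A).

Definition DLrel_comp (A B C : DLob) (R : DLrel A B) (S : DLrel B C) :
  DLrel A C := DLRel (is_DLrel_comp (DLrelP R) (DLrelP S)).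

Definition Prirel_id (X : Priob) : Prirel X X := PriRel (is_Prirel_id X).

Definition Prirel_comp (X Y Z : Priob) (r : Prirel X Y) (s : Prirel Y Z) :
  Prirel X Z := PriRel (is_Prirel_comp (PrirelP r) (PrirelP s)).

#[local] Obligation Tactic := idtac.

Program Definition RelDL : ordCat :=
  @OrdCat DLob (fun A B => DLrel A B) (fun A B R S => (R `<=` S)%classic)
    DLrel_id DLrel_comp _ _ _ _ _ _ _.
Next Obligation. by move=> *; exact: subset_refl. Qed.
Next Obligation. by move=> A B R S T; exact: subset_trans. Qed.
Next Obligation. by move=> A B R S RS SR; apply/DLrel_inj/seteqP. Qed.
Next Obligation. by move=> *; exact: rel_compS. Qed.
Next Obligation.
by move=> A B R; apply: DLrel_inj; apply: rel_comp1r; case: (DLrelP R).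
Qed.
Next Obligation.
by move=> A B R; apply: DLrel_inj; apply: rel_compr1; case: (DLrelP R).
Qed.
Next Obligation. by move=> *; apply: DLrel_inj; exact: rel_compA. Qed.

Program Definition RelPri : ordCat :=
  @OrdCat Priob (fun X Y => Prirel X Y) (fun X Y r s => (r `<=` s)%classic)
    Prirel_id Prirel_comp _ _ _ _ _ _ _.
Next Obligation. by move=> *; exact: subset_refl. Qed.
Next Obligation. by move=> X Y r s t; exact: subset_trans. Qed.
Next Obligation. by move=> X Y r s rs sr; apply/Prirel_inj/seteqP. Qed.
Next Obligation. by move=> *; exact: rel_compS. Qed.
Next Obligation.
by move=> X Y r; apply: Prirel_inj; apply: rel_comp1r; case: (PrirelP r).
Qed.
Next Obligation.
by move=> X Y r; apply: Prirel_inj; apply: rel_compr1; case: (PrirelP r).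
Qed.
Next Obligation. by move=> *; apply: Prirel_inj; exact: rel_compA. Qed.

Definition two_Pri (X : Priob) : DLob := DLOb (clopenUpset X).

Definition two_DL (A : DLob) : Priob := PriOb (primeFilter A).

Definition bar_two_Pri {d d'} {X : priestleyType d} {Y : priestleyType d'}
    (r : set (X * Y)) : set (clopenUpset X * clopenUpset Y) :=
  [set ab : clopenUpset X * clopenUpset Y |
    forall x y, r (x, y) -> (ab.1 : set X) x -> (ab.2 : set Y) y].

Definition bar_two_DL {d d'} {A : tbDistrLatticeType d}
    {B : tbDistrLatticeType d'} (R : set (A * B)) :
    set (primeFilter A * primeFilter B) :=
  [set xy : primeFilter A * primeFilter B |
    forall a b, R (a, b) -> (xy.1 : set A) a -> (xy.2 : set B) b].

(* Main.v *)
From HB Require Import structures.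
Require Import Defs.
From mathcomp Require Import all_boot all_order.
From mathcomp Require Import all_classical topology.

(* The relations [R] and [bar_two R] determine each other through separation:
   in a distributive lattice by the prime filter theorem, in a Priestley space
   by finding a clopen up-set between two compact sets.  Given a pair related by
   the dual of a composite, the intermediate point is a prime filter separating
   the filter [R[x]] from the ideal of elements that [S] relates to the
   complement of [z]; dually, it is a clopen up-set separating a compact direct
   image from a compact inverse image.  The units [x |-> {a | x \in a}] and
   [a |-> {x | a \in x}] are surjective order embeddings, so their lower and
   upper stars are mutually inverse relations, and naturality amounts to the
   equivalence of [R (a, b)] with the relatedness of the images of [a] and [b]
   in the double dual. *)

Set Implicit Arguments.
Unset Strict Implicit.
Unset Printing Implicit Defensive.

Import Order.TTheory.

Local Open Scope order_scope.
Local Open Scope classical_set_scope.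

(** * Compactness and separation by lattices of clopen sets *)

(** Closure of [D] under intersection makes the traces on [K] a base of a proper filter; a cluster
    point of it in [K] lies in every closed member of [D]. *)
Lemma compact_directed_meet (T : topologicalType) (K : set T)
    (D : set (set T)) :
  compact K -> D !=set0 -> (forall U V, D U -> D V -> D (U `&` V)) ->
  (forall U, D U -> closed U) -> (forall U, D U -> K `&` U !=set0) ->
  exists2 k, K k & forall U, D U -> U k.
Proof.
move=> cK [U0 DU0] DI Dc Dn0.
have FF : ProperFilter (filter_from D (fun U => K `&` U)).
  apply: filter_from_proper => //; apply: filter_from_filter; first by exists U0.
  move=> U V DU DV; exists (U `&` V); first exact: DI.
  by move=> x [Kx [Ux Vx]].
have [k [Kk clk]] : K `&` cluster (filter_from D (fun U => K `&` U)) !=set0.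
  by apply: cK; exists U0 => // x [].
exists k => // U DU; apply: (Dc _ DU) => W kW.
by have [|x [[_ Ux] Wx]] := clk (K `&` U) W _ kW; [exists U|exists x].
Qed.

(* Compactness is applied twice: first to [L] for a fixed point of [K], then to
   [K]. *)
Lemma clopen_lattice_separation (T : topologicalType) (B : set (set T))
    (K L : set T) :
  B set0 -> B setT ->
  (forall U V, B U -> B V -> B (U `&` V)) ->
  (forall U V, B U -> B V -> B (U `|` V)) ->
  (forall U, B U -> clopen U) -> compact K -> compact L ->
  (forall k l, K k -> L l -> exists U, [/\ B U, U k & ~ U l]) ->
  exists U, [/\ B U, K `<=` U & forall l, L l -> ~ U l].
Proof.
move=> B0 BT BI BU Bc cK cL sep.
have sepL k : K k -> exists U, [/\ B U, U k & forall l, L l -> ~ U l].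
  move=> Kk; apply: contrapT => nU.
  (* If every member of [B] around [k] met [L], a single [l] in [L] would lie in all of them,
     against [sep]. *)
  have [||||l Ll lU] := @compact_directed_meet _ L [set U | B U /\ U k] cL.
  - by exists setT.
  - by move=> U V [BU_ Uk] [BV Vk]; split; [exact: BI|].
  - by move=> U [/Bc[]].
  - move=> U [BU_ Uk]; apply: contrapT => n0; apply: nU; exists U; split=> //.
    by move=> l Ll Ul; apply: n0; exists l.
  - have [U [BU_ Uk nUl]] := sep _ _ Kk Ll.
    by apply: nUl; apply: lU.
apply: contrapT => nU.
(* The same argument for the complements of the members of [B] that miss [L]; a point of [K] common
   to all of them contradicts [sepL]. *)
have [||||k Kk kU] := @compact_directed_meet _ K
    [set V | exists U, [/\ B U, V = ~` U & forall l, L l -> ~ U l]] cK.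
- by exists setT, set0; split=> [||l _ []] //; rewrite setC0.
- move=> _ _ [U [BU_ -> UL]] [V [BV -> VL]]; exists (U `|` V).
  split; [exact: BU|by rewrite setCU|].
  by move=> l Ll [/UL|/VL]; apply.
- by move=> _ [U [/Bc[oU _] -> _]]; exact: open_closedC.
- move=> _ [U [BU_ -> UL]]; apply: contrapT => n0; apply: nU.
  exists U; split=> // k Kk; apply: contrapT => nUk; apply: n0.
  by exists k.
- have [U [BU_ Uk UL]] := sepL _ Kk.
  by have : (~` U) k by apply: kU; exists U.
Qed.

(** * The prime filter theorem *)

Section PrimeFilterTheorem.
Context {d : Order.disp_t} {A : tbDistrLatticeType d}.

Definition lattice_filter (F : set A) : Prop :=
  [/\ F \top%O, up_closed F & forall a b, F a -> F b -> F (a `&` b)%O].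

Definition lattice_ideal (I : set A) : Prop :=
  [/\ I \bot%O, forall a b, (a <= b)%O -> I b -> I a
    & forall a b, I a -> I b -> I (a `|` b)%O].

(** Zorn's lemma gives a filter [M] maximal among those containing [F] and avoiding [I]; maximality
    and distributivity make it prime. *)
Lemma prime_filter_separation (F I : set A) :
  lattice_filter F -> lattice_ideal I -> (forall a, F a -> ~ I a) ->
  exists x : primeFilter A,
    F `<=` (x : set A) /\ forall a, I a -> ~ (x : set A) a.
Proof.
move=> fF [I0 Idown IU] FI.
pose good (M : set A) :=
  [/\ lattice_filter M, F `<=` M & forall a, M a -> ~ I a].
have [M [goodM maxM]] : exists M, (M = set0 \/ good M) /\
    forall N, M `<` N -> ~ (N = set0 \/ good N).
  (* [Zorn_bigcup] includes the empty chain, whence the disjunct [M = set0]. *)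
  apply: Zorn_bigcup => C CP Ctot.
  have [[M [CM gM]]|nC] := pselect (exists M, C M /\ good M); last first.
    left; apply/seteqP; split=> // a [M CM Ma].
    by have [M0|gM] := CP _ CM; [rewrite M0 in Ma|apply: nC; exists M].
  have goodC N a : C N -> N a -> good N.
    by move=> CN Na; have [N0|//] := CP _ CN; rewrite N0 in Na.
  right; split.
  - split.
    + by exists M => //; have [[]] := gM.
    + move=> a b ab [N CN Na]; exists N => //.
      by have [[_ up _] _ _] := goodC _ _ CN Na; exact: up Na.
    + move=> a b [N CN Na] [N' CN' N'b].
      have [[_ _ NI] _ _] := goodC _ _ CN Na.
      have [[_ _ N'I] _ _] := goodC _ _ CN' N'b.
      have [NN'|N'N] := Ctot _ _ CN CN'.
        by exists N' => //; apply: N'I => //; exact: NN'.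
      by exists N => //; apply: NI => //; exact: N'N.
  - by move=> a Fa; exists M => //; have [_ FM _] := gM; exact: FM.
  - move=> a [N CN Na]; have [_ _ NI] := goodC _ _ CN Na; exact: NI.
have {goodM} gM : good M.
  case: goodM => // M0; exfalso; apply: (maxM F); last by right; split.
  rewrite M0; split=> // F0; have [F1 _ _] := fF; exact: (F0 _ F1).
have [[M1 Mup Mmeet] FM MdI] := gM.
have adjoin a : ~ M a -> exists2 m, M m & I (m `&` a)%O.
  move=> nMa; apply: contrapT => nm.
  (* The filter generated by [M] and [a] properly extends [M], so by maximality it must meet [I]. *)
  apply: (maxM [set c | exists2 m, M m & (m `&` a <= c)%O]).
    split=> [c Mc|]; first by exists c => //; exact: leIl.
    by move=> sub; apply: nMa; apply: sub; exists \top%O => //; exact: leIr.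
  right; split; first split.
  - by exists \top%O => //; exact: lex1.
  - by move=> b c bc [m Mm mb]; exists m => //; exact: le_trans bc.
  - move=> b c [m Mm mb] [m' Mm' mc]; exists (m `&` m')%O; first exact: Mmeet.
    rewrite lexI (le_trans _ mb) ?(le_trans _ mc) //.
      by rewrite leI2 // leIr.
    by rewrite leI2 // leIl.
  - by move=> b Fb; exists b; [exact: FM|exact: leIl].
  - by move=> b [m Mm mb] Ib; apply: nm; exists m => //; exact: Idown Ib.
have Mprime : prime_filter M.
  apply/asboolP; split=> //; first by move=> M0; exact: MdI M0 I0.
  move=> a b Mab; apply: contrapT => /not_orP[/adjoin[m Mm Ima] /adjoin[n Mn Inb]].
  (* This element of [M] lies, by distributivity, below the join of the meets of [m] with [a] and of
     [n] with [b], which is in [I]. *)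
  apply: (MdI ((m `&` n) `&` (a `|` b))%O); first exact: Mmeet (Mmeet _ _ Mm Mn) Mab.
  apply: Idown (IU _ _ Ima Inb); rewrite meetUr leU2 // leI2 //.
    exact: leIl.
  exact: leIr.
by exists (PrimeFilter Mprime); split=> // a Ia /= Ma; exact: MdI Ma Ia.
Qed.

End PrimeFilterTheorem.

(** * Order isomorphisms as invertible relations, and naturality squares *)

Section OrderIsomorphisms.
Context {d d' : Order.disp_t} {A : porderType d} {A' : porderType d'}.
Variable e : A -> A'.
Hypothesis e_mono : {mono e : a b / (a <= b)%O}.
Hypothesis e_surj : forall a', exists a, e a = a'.

Lemma rel_comp_lower_upper_star :
  rel_comp (lower_star e) (upper_star e) = rel_id.
Proof.
apply/seteqP; split=> -[a b] /=.
  by move=> [a' /= ea eb]; rewrite /rel_id/= -e_mono; exact: le_trans eb.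
by move=> ab; exists (e b); rewrite /lower_star /upper_star /= ?e_mono.
Qed.

Lemma rel_comp_upper_lower_star :
  rel_comp (upper_star e) (lower_star e) = rel_id.
Proof.
apply/seteqP; split=> -[a b] /=.
  by move=> [a' /= ea eb]; exact: le_trans eb.
have [a' <-] := e_surj a.
by move=> ab; exists a'; rewrite /lower_star /upper_star /=.
Qed.

End OrderIsomorphisms.

Section OrderIsomorphismNaturality.
Context {d1 d1' d2 d2' : Order.disp_t}.
Context {A : porderType d1} {A' : porderType d1'}.
Context {B : porderType d2} {B' : porderType d2'}.
Variables (e : A -> A') (h : B -> B').
Hypothesis e_surj : forall a', exists a, e a = a'.
Hypothesis h_surj : forall b', exists b, h b = b'.
Variables (R : set (A * B)) (R' : set (A' * B')).
Hypothesis wR' : weakening R'.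
Hypothesis RE : forall a b, R' (e a, h b) <-> R (a, b).

(** Stated for posets, so that both units are covered: [R'] will be the double dual of [R], and [RE]
    what the separation lemmas provide. A point of a primed poset is replaced by a preimage, which
    reduces the square to [RE]. *)
Lemma rel_comp_lower_star_natural :
  rel_comp R (lower_star h) = rel_comp (lower_star e) R'.
Proof.
apply/seteqP; split=> -[a b'] /=.
  move=> [b Rab hb]; exists (e a); first exact: lexx.
  by apply: wR' hb; [exact: lexx|exact/RE].
have [b <-] := h_surj b'; move=> [a' /= ea R'a'b].
exists b; last exact: lexx.
by apply/RE; exact: wR' ea R'a'b (lexx _).
Qed.

Lemma rel_comp_upper_star_natural :
  rel_comp R' (upper_star h) = rel_comp (upper_star e) R.
Proof.
apply/seteqP; split=> -[a' b] /=.
  have [a <-] := e_surj a'; move=> [b' R'ab' /= b'b].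
  exists a; first exact: lexx.
  by apply/RE; exact: wR' (lexx _) R'ab' b'b.
move=> [a /= a'a Rab]; exists (h b); last exact: lexx.
by apply: wR' a'a _ (lexx _); exact/RE.
Qed.

End OrderIsomorphismNaturality.

(** * Separation and closed relations in Priestley spaces *)

Lemma clopenUpsetP d (X : priestleyType d) (a : clopenUpset X) :
  clopen (a : set X) /\ up_closed (a : set X).
Proof. by case: a => a /= /asboolP. Qed.

Lemma clopenUpset_leP d (X : priestleyType d) (a b : clopenUpset X) :
  reflect ((a : set X) `<=` (b : set X)) (a <= b)%O.
Proof. by rewrite -Order.le_val; exact: subsetPset. Qed.

Lemma clopenUpset_ext d (X : priestleyType d) (a b : clopenUpset X) :
  (a : set X) = b -> a = b.
Proof. exact: val_inj. Qed.

Lemma primeFilter_ext d (A : tbDistrLatticeType d) (x y : primeFilter A) :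
  (x : set A) = y -> x = y.
Proof. exact: val_inj. Qed.

(** The Priestley axiom separates single points; clopen up-sets form a bounded lattice of sets, so
    compactness extends this to [K] and [L]. *)
Lemma clopenUpset_separation d (X : priestleyType d) (K L : set X) :
  compact K -> compact L -> (forall k l, K k -> L l -> ~ (k <= l)%O) ->
  exists a : clopenUpset X,
    K `<=` (a : set X) /\ forall l, L l -> ~ (a : set X) l.
Proof.
move=> cK cL KL.
have [||||||U [/asboolP UP KU UL]] := @clopen_lattice_separation X
    [set U | clopen U /\ up_closed U] K L _ _ _ _ _ cK cL.
- by split; [exact: clopen0|move=> x y _ []].
- by split; [exact: clopenT|].
- move=> U V [cU uU] [cV uV]; split; first exact: clopenI.
  by move=> x y xy [Ux Vx]; split; [exact: uU Ux|exact: uV Vx].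
- move=> U V [cU uU] [cV uV]; split; first exact: clopenU.
  by move=> x y xy [Ux|Vx]; [left; exact: uU Ux|right; exact: uV Vx].
- by move=> U [].
- move=> k l Kk Ll.
  by have [U [cU uU Uk Ul]] := priestley_separation _ _ (KL _ _ Kk Ll); exists U.
- by exists (ClopenUpset UP).
Qed.

Section PriRelationImages.
Context {d d' : Order.disp_t} {X : priestleyType d} {Y : priestleyType d'}.

Lemma closed_compact_priestley (K : set X) : closed K -> compact K.
Proof.
by move=> cK; apply: (subclosed_compact cK (@priestley_compact _ X)).
Qed.

Lemma compact_prod_priestley : compact [set: X * Y].
Proof. by rewrite -setXTT; apply: compact_setX; exact: priestley_compact. Qed.

Variable r : set (X * Y).
Hypothesis closed_r : closed r.

(** The image is the projection of the part of [r] over [K], which is closed in a compact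
    product. *)
Lemma compact_rel_image (K : set X) : closed K ->
  compact [set y | exists2 x, K x & r (x, y)].
Proof.
move=> cK.
have -> : [set y | exists2 x, K x & r (x, y)] = snd @` (r `&` fst @^-1` K).
  apply/seteqP; split=> [y [x Kx rxy]|y [[x z] [/= rxz Kx] <-]].
    by exists (x, y).
  by exists x.
apply: continuous_compact.
  by apply: continuous_subspaceT => z; exact: cvg_snd.
apply: (subclosed_compact _ compact_prod_priestley) => //.
apply: closedI => //; apply: preimage_closed => // z _; exact: cvg_fst.
Qed.

Lemma compact_rel_preimage (L : set Y) : closed L ->
  compact [set x | exists2 y, L y & r (x, y)].
Proof.
move=> cL.
have -> : [set x | exists2 y, L y & r (x, y)] = fst @` (r `&` snd @^-1` L).
  apply/seteqP; split=> [x [y Ly rxy]|x [[z y] [/= rzy Ly] <-]].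
    by exists (x, y).
  by exists y.
apply: continuous_compact.
  by apply: continuous_subspaceT => z; exact: cvg_fst.
apply: (subclosed_compact _ compact_prod_priestley) => //.
apply: closedI => //; apply: preimage_closed => // z _; exact: cvg_snd.
Qed.

End PriRelationImages.

(** The space is Hausdorff: by antisymmetry, distinct points fail [<=] in some direction, and the
    separating clopen up-set and its complement are disjoint neighbourhoods. *)
Lemma priestley_closed1 d (X : priestleyType d) (x : X) : closed [set x].
Proof.
apply: accessible_closed_set1; apply: hausdorff_accessible.
rewrite open_hausdorff => y z /eqP yz.
have [nle|nle] : ~ (y <= z)%O \/ ~ (z <= y)%O.
- apply: contrapT => /not_orP[/contrapT yz' /contrapT zy]; apply: yz.
  by apply/eqP; rewrite eq_le yz' zy.
- have [U [[oU cU] _ Uy Uz]] := priestley_separation _ _ nle.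
  exists (U, ~` U); split=> /=; rewrite ?inE //; last exact: setICr.
  exact: closed_openC.
- have [U [[oU cU] _ Uz Uy]] := priestley_separation _ _ nle.
  exists (~` U, U); split=> /=; rewrite ?inE //; last exact: setICl.
  exact: closed_openC.
Qed.

(** * The dual of a Priestley relation *)

Section BarTwoPri.
Context {d1 d2 d3 : Order.disp_t}.
Context {X : priestleyType d1} {Y : priestleyType d2} {Z : priestleyType d3}.

Lemma is_DLrel_bar_two_Pri (r : set (X * Y)) : is_DLrel (bar_two_Pri r).
Proof.
split.
- move=> a' a b b' /clopenUpset_leP a'a ab /clopenUpset_leP bb' x y rxy a'x.
  by apply: bb'; apply: ab rxy _; exact: a'a.
- by move=> x y _ [].
- by [].
- move=> a b a' b' ab ab' x y rxy [ax a'x].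
  by split; [exact: ab rxy ax|exact: ab' rxy a'x].
- move=> a b a' b' ab ab' x y rxy [ax|a'x].
    by left; exact: ab rxy ax.
  by right; exact: ab' rxy a'x.
Qed.

Lemma bar_two_Pri_id : bar_two_Pri (@rel_id _ X) = rel_id.
Proof.
apply/seteqP; split=> -[a b] /= ab.
  by apply/clopenUpset_leP => x ax; apply: (ab x x) => //; exact: lexx.
move=> x y xy ax; have [_ ub] := clopenUpsetP b; apply: ub xy _.
by have /clopenUpset_leP := ab; apply.
Qed.

Lemma bar_two_Pri_comp (r : set (X * Y)) (s : set (Y * Z)) :
  is_Prirel r -> is_Prirel s ->
  bar_two_Pri (rel_comp r s) = rel_comp (bar_two_Pri r) (bar_two_Pri s).
Proof.
move=> [wr cr] [ws cs]; apply/seteqP; split=> -[a c] /=; last first.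
  move=> [b ab bc] x z [y rxy syz] ax.
  by apply: bc syz _; exact: ab rxy ax.
move=> ac.
have [[_ cla] _] := clopenUpsetP a; have [[oc _] _] := clopenUpsetP c.
(* The image of [a] under [r] is separated from the points that [s] relates outside [c]: a point of
   the former below one of the latter would, by weakening of [s], give a composite pair leading from
   [a] out of [c]. *)
have := @clopenUpset_separation _ Y _ _ (compact_rel_image cr cla)
  (compact_rel_preimage cs (open_closedC oc)).
move=> [y y' [x ax rxy] [z ncz sy'z] yy'|b [ab bc]].
  by apply: ncz; apply: (ac x z) ax; exists y => //; exact: ws yy' sy'z (lexx _).
exists b => [x y rxy ax|y z syz byy] /=; first by apply: ab; exists x.
by apply: contrapT => ncz; apply: (bc y) byy; exists z.
Qed.

(** Since [b] is an up-set, the condition need only be tested on the pairs [(x, f x)]. *)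
Lemma bar_two_Pri_lower_star (f : priMorphism X Y) :
  bar_two_Pri (lower_star f) = upper_star (dualPri f).
Proof.
apply/seteqP; split=> -[a b] /= ab.
  by apply/clopenUpset_leP => x ax; apply: (ab x (f x)) => //; exact: lexx.
move=> x y fxy ax; have [_ ub] := clopenUpsetP b; apply: ub fxy _.
by have /clopenUpset_leP := ab; apply.
Qed.

(* For [~ r (x, y)], [b] separates the up-set [r[x]] from [y], and then [a]
   separates [x] from the down-set of points related to the complement of [b]. *)
Lemma bar_two_Pri_separation (r : set (X * Y)) x y : is_Prirel r ->
  (forall a b, bar_two_Pri r (a, b) -> (a : set X) x -> (b : set Y) y) ->
  r (x, y).
Proof.
move=> [wr cr] H; apply: contrapT => nrxy.
have [y1 y2 [_ -> rxy] -> y12|b [rb nby]] := @clopenUpset_separation _ Y _ _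
    (compact_rel_image cr (@priestley_closed1 _ X x))
    (closed_compact_priestley (@priestley_closed1 _ Y y)).
  by apply: nrxy; exact: wr (lexx _) rxy y12.
have [[ob _] _] := clopenUpsetP b.
have [_ x2 -> [z nbz rxz] xx2|a [xa na]] := @clopenUpset_separation _ X _ _
    (closed_compact_priestley (@priestley_closed1 _ X x))
    (compact_rel_preimage cr (open_closedC ob)).
  by apply: nbz; apply: rb; exists x => //; exact: wr xx2 rxz (lexx _).
apply: (nby y) => //; apply: (H a); last exact: xa.
move=> x' y' rxy' ax'; apply: contrapT => nby'.
by apply: (na x') ax'; exists y'.
Qed.

End BarTwoPri.

(** * The dual of a lattice relation *)

Section BarTwoDL.
Context {d1 d2 d3 : Order.disp_t}.
Context {A : tbDistrLatticeType d1} {B : tbDistrLatticeType d2}.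
Context {C : tbDistrLatticeType d3}.

(** For closedness: the pair in [R] witnessing that [(x, y)] is excluded also excludes a whole box
    of basic clopen sets around it. *)
Lemma is_Prirel_bar_two_DL (R : set (A * B)) : is_Prirel (bar_two_DL R).
Proof.
split.
  move=> x' x y y' /primeFilter_leP x'x xy /primeFilter_leP yy' a b Rab x'a.
  by apply: yy'; apply: xy Rab _; exact: x'x.
rewrite -openC openE => -[x y] /= /existsNP[a /existsNP[b]].
move=> /not_implyP[Rab /not_implyP[xa nyb]].
exists (basic_upset a, ~` basic_upset b); first split => /=.
- by apply: open_nbhs_nbhs; split=> //; have [] := basic_upset_clopen a.
- apply: open_nbhs_nbhs; split=> //; apply: closed_openC.
  by have [] := basic_upset_clopen b.
by move=> [x' y'] [/= x'a ny'b] xy'; apply: ny'b; exact: xy' Rab x'a.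
Qed.

Lemma bar_two_DL_id : bar_two_DL (@rel_id _ A) = rel_id.
Proof.
apply/seteqP; split=> -[x y] /= xy.
  by apply/primeFilter_leP => a xa; apply: (xy a a) => //; exact: lexx.
move=> a b ab xa; have [_ _ uy _ _] := primeFilterP y; apply: uy ab _.
by have /primeFilter_leP := xy; apply.
Qed.

(** Here the meet half of the sublattice condition enters, and the join half in the companion for
    ideals; both prepare uses of [prime_filter_separation]. *)
Lemma lattice_filter_rel_image (R : set (A * B)) (F : set A) :
  is_DLrel R -> lattice_filter F ->
  lattice_filter [set b | exists2 a, F a & R (a, b)].
Proof.
move=> [wR _ R1 RI _] [F1 _ FI]; split.
- by exists \top%O.
- by move=> b b' bb' [a Fa Rab]; exists a => //; exact: wR (lexx _) Rab bb'.
- move=> b b' [a Fa Rab] [a' Fa' Rab'].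
  by exists (a `&` a')%O; [exact: FI|exact: RI].
Qed.

Lemma lattice_ideal_rel_preimage (R : set (A * B)) (I : set B) :
  is_DLrel R -> lattice_ideal I ->
  lattice_ideal [set a | exists2 b, I b & R (a, b)].
Proof.
move=> [wR R0 _ _ RU] [I0 _ IU]; split.
- by exists \bot%O.
- by move=> a a' aa' [b Ib Rab]; exists b => //; exact: wR aa' Rab (lexx _).
- move=> a a' [b Ib Rab] [b' Ib' Rab'].
  by exists (b `|` b')%O; [exact: IU|exact: RU].
Qed.

End BarTwoDL.

Section PrimeFilterIdeals.
Context {d : Order.disp_t} {A : tbDistrLatticeType d}.

Lemma lattice_filter_prime (x : primeFilter A) : lattice_filter (x : set A).
Proof. by have [x1 _ ux xI _] := primeFilterP x. Qed.

Lemma lattice_ideal_primeC (x : primeFilter A) :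
  lattice_ideal (~` (x : set A)).
Proof.
have [_ x0 ux _ xU] := primeFilterP x; split=> //.
  by move=> a b ab nxb xa; apply: nxb; exact: ux xa.
by move=> a b nxa nxb /xU[].
Qed.

Lemma lattice_filter_principal (a : A) : lattice_filter [set b | (a <= b)%O].
Proof.
split=> /= [|b c bc ab|b c ab ac]; first exact: lex1.
  exact: le_trans bc.
by rewrite lexI ab.
Qed.

Lemma lattice_ideal_principal (a : A) : lattice_ideal [set b | (b <= a)%O].
Proof.
split=> /= [|b c bc|b c ab ac]; first exact: le0x.
  exact: le_trans.
by rewrite leUx ab.
Qed.

End PrimeFilterIdeals.

Section BarTwoDLFunctor.
Context {d1 d2 d3 : Order.disp_t}.
Context {A : tbDistrLatticeType d1} {B : tbDistrLatticeType d2}.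
Context {C : tbDistrLatticeType d3}.

Lemma bar_two_DL_comp (R : set (A * B)) (S : set (B * C)) :
  is_DLrel R -> is_DLrel S ->
  bar_two_DL (rel_comp R S) = rel_comp (bar_two_DL R) (bar_two_DL S).
Proof.
move=> DR DS; apply/seteqP; split=> -[x z] /=; last first.
  move=> [y xy yz] a c [b Rab Sbc] xa.
  by apply: yz Sbc _; exact: xy Rab xa.
move=> xz.
have [b [a xa Rab] [c nzc Sbc]|y [xy yz]] := prime_filter_separation
    (lattice_filter_rel_image DR (lattice_filter_prime x))
    (lattice_ideal_rel_preimage DS (lattice_ideal_primeC z)).
  by apply: nzc; apply: (xz a c) xa; exists b.
exists y => [a b Rab xa|b c Sbc yb] /=; first by apply: xy; exists a.
by apply: contrapT => nzc; apply: (yz b) yb; exists c.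
Qed.

Lemma bar_two_DL_upper_star (g : dlMorphism A B) :
  bar_two_DL (upper_star g) = lower_star (dualDL g).
Proof.
apply/seteqP; split=> -[y x] /= yx.
  by apply/primeFilter_leP => a ya; apply: (yx (g a) a) => //; exact: lexx.
move=> b a bga yb; have /primeFilter_leP := yx; apply.
by have [_ _ uy _ _] := primeFilterP y; exact: uy yb.
Qed.

(* For [~ R (a, b)], [y] separates the filter [R[a]] from [b], and then [x]
   separates [a] from the ideal of elements related to the complement of [y]. *)
Lemma bar_two_DL_separation (R : set (A * B)) a b : is_DLrel R ->
  (forall x y, bar_two_DL R (x, y) -> (x : set A) a -> (y : set B) b) ->
  R (a, b).
Proof.
move=> DR H; have [wR _ _ _ _] := DR; apply: contrapT => nRab.
have [b' [a' aa' Ra'b'] b'b|y [Ry ny]] := prime_filter_separation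
    (lattice_filter_rel_image DR (lattice_filter_principal a))
    (lattice_ideal_principal b).
  by apply: nRab; exact: wR aa' Ra'b' b'b.
have [a' aa' [b' nyb' Rab']|x [ax nx]] := prime_filter_separation
    (lattice_filter_principal a)
    (lattice_ideal_rel_preimage DR (lattice_ideal_primeC y)).
  by apply: nyb'; apply: Ry; exists a' => //.
apply: (ny b); first exact: lexx.
apply: (H x y); last by apply: ax; exact: lexx.
move=> a' b' Rab' xa'; apply: contrapT => nyb'.
by apply: (nx a') xa'; exists b'.
Qed.

End BarTwoDLFunctor.

(** * The units of the duality *)

Section PriUnit.
Context {d : Order.disp_t} {X : priestleyType d}.

Fact pri_unit_subproof (x : X) :
  prime_filter [set a : clopenUpset X | (a : set X) x].
Proof.
apply/asboolP; split=> //=.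
by move=> a b /clopenUpset_leP ab; exact: ab.
Qed.

Definition pri_unit (x : X) : primeFilter (clopenUpset X) :=
  PrimeFilter (pri_unit_subproof x).

Lemma pri_unit_mono : {mono pri_unit : x y / (x <= y)%O}.
Proof.
move=> x y; apply/primeFilter_leP/idP => [xy|xy a /= ax].
  apply: contrapT => nxy.
  have [U [cU uU Ux Uy]] := priestley_separation _ _ nxy.
  have UP : clopen_upset U by exact/asboolP.
  by apply: Uy; exact: (xy (ClopenUpset UP)).
by have [_ ua] := clopenUpsetP a; exact: ua ax.
Qed.

Fact pri_unit_continuous : continuous pri_unit.
Proof.
move=> x; apply: primeFilter_cvg => U [a [->|->]] Ux.
- by apply: open_nbhs_nbhs; split=> //; have [[]] := clopenUpsetP a.
- apply: open_nbhs_nbhs; split=> //.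
  apply: (@closed_openC _ (a : set X)).
  by have [[]] := clopenUpsetP a.
Qed.
HB.instance Definition _ := isContinuous.Build _ _ pri_unit pri_unit_continuous.

Fact pri_unit_le : {homo pri_unit : x y / (x <= y)%O}.
Proof. by move=> x y; rewrite pri_unit_mono. Qed.
HB.instance Definition _ :=
  Order.isOrderMorphism.Build _ _ _ _ pri_unit pri_unit_le.

(* A point [x] realises [p] as soon as it lies in all the closed sets
   [a `&` ~` b] with [a] in [p] and [b] outside [p]. *)
Lemma pri_unit_surj (p : primeFilter (clopenUpset X)) :
  exists x, pri_unit x = p.
Proof.
have [p1 p0 up pI pU] := primeFilterP p.
have [||||x _ xp] := @compact_directed_meet X setT
    [set U | exists a b : clopenUpset X, [/\ (p : set _) a, ~ (p : set _) b
       & U = (a : set X) `&` ~` (b : set X)]] (@priestley_compact _ X).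
- by exists (setT `&` ~` set0), \top%O, \bot%O.
- move=> _ _ [a [b [pa npb ->]]] [a' [b' [pa' npb' ->]]].
  exists (a `&` a')%O, (b `|` b')%O; split; first exact: pI.
    by move=> /pU[].
  by rewrite setIACA -setCU.
- move=> _ [a [b [pa npb ->]]]; apply: closedI.
    by have [[]] := clopenUpsetP a.
  by apply: open_closedC; have [[]] := clopenUpsetP b.
(* Emptiness would mean [a <= b], which would put [b] in [p]. *)
- move=> _ [a [b [pa npb ->]]]; apply: contrapT => n0; apply: npb.
  apply: up pa; apply/clopenUpset_leP => x ax; apply: contrapT => nbx.
  by apply: n0; exists x.
(* The pairs [(\top, a)] and [(a, \bot)] yield the two inclusions. *)
exists x; apply: primeFilter_ext; apply/seteqP; split=> a /= H.
  apply: contrapT => npa.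
  have [] : ((\top%O : clopenUpset X) : set X) x /\ (~` (a : set X)) x => //.
  by apply: (xp (_ `&` _)); exists \top%O, a.
have [] // : (a : set X) x /\ (~` ((\bot%O : clopenUpset X) : set X)) x.
by apply: (xp (_ `&` _)); exists a, \bot%O.
Qed.

End PriUnit.

Section DLUnit.
Context {d : Order.disp_t} {A : tbDistrLatticeType d}.

Fact dl_unit_subproof (a : A) : clopen_upset (basic_upset a).
Proof.
apply/asboolP; split; first exact: basic_upset_clopen.
by move=> x y /primeFilter_leP; exact.
Qed.

Definition dl_unit (a : A) : clopenUpset (primeFilter A) :=
  ClopenUpset (dl_unit_subproof a).

Lemma dl_unit_mono : {mono dl_unit : a b / (a <= b)%O}.
Proof.
move=> a b; apply/clopenUpset_leP/idP => [ab|ab x /= xa].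
  (* For the identity relation, separation says that prime filters detect the order. *)
  apply: (bar_two_DL_separation (is_DLrel_id A)) => x y xy xa.
  by apply: (xy b b); [exact: lexx|exact: ab].
by have [_ _ ux _ _] := primeFilterP x; exact: ux xa.
Qed.

Fact dl_unit_le : {homo dl_unit : a b / (a <= b)%O}.
Proof. by move=> a b; rewrite dl_unit_mono. Qed.
HB.instance Definition _ :=
  Order.isOrderMorphism.Build _ _ _ _ dl_unit dl_unit_le.

Fact dl_unit_meet : {morph dl_unit : a b / (a `&` b)%O}.
Proof.
move=> a b; apply: clopenUpset_ext; apply/seteqP; split=> x /=.
  have [_ _ ux _ _] := primeFilterP x.
  by move=> xab; split; apply: ux xab; [exact: leIl|exact: leIr].
by have [_ _ _ xI _] := primeFilterP x; move=> [xa xb]; exact: xI.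
Qed.

Fact dl_unit_join : {morph dl_unit : a b / (a `|` b)%O}.
Proof.
move=> a b; apply: clopenUpset_ext; apply/seteqP; split=> x /=.
  by have [_ _ _ _ xU] := primeFilterP x; exact: xU.
have [_ _ ux _ _] := primeFilterP x.
by move=> [|]; apply: ux; [exact: leUl|exact: leUr].
Qed.
HB.instance Definition _ := Order.isLatticeMorphism.Build _ _ _ _ dl_unit
  dl_unit_meet dl_unit_join.

Fact dl_unit_bot : dl_unit \bot%O = \bot%O.
Proof.
apply: clopenUpset_ext; apply/seteqP; split=> x //=.
by have [] := primeFilterP x.
Qed.

Fact dl_unit_top : dl_unit \top%O = \top%O.
Proof.
apply: clopenUpset_ext; apply/seteqP; split=> x //= _.
by have [] := primeFilterP x.
Qed.
HB.instance Definition _ := Order.isBLatticeMorphism.Build _ _ _ _ dl_unit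
  dl_unit_bot.
HB.instance Definition _ := Order.isTLatticeMorphism.Build _ _ _ _ dl_unit
  dl_unit_top.

(** The sets [basic_upset a] form a bounded lattice of clopen sets, and separate points of the
    up-set [U] from points outside it. Compactness of [U] and of its complement then yields one [a]
    for all of them. *)
Lemma dl_unit_surj (U : clopenUpset (primeFilter A)) :
  exists a, dl_unit a = U.
Proof.
have [[oU cU] uU] := clopenUpsetP U.
have [||||||||_ [[a _ <-] KU UL]] := @clopen_lattice_separation _
    (range (fun a => dl_unit a : set _)) (U : set _) (~` (U : set _)).
- by exists \bot%O => //; rewrite omorph0.
- by exists \top%O => //; rewrite omorph1.
- by move=> _ _ [a _ <-] [b _ <-]; exists (a `&` b)%O => //; rewrite omorphI.
- by move=> _ _ [a _ <-] [b _ <-]; exists (a `|` b)%O => //; rewrite omorphU.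
- by move=> _ [a _ <-]; exact: basic_upset_clopen.
- exact: closed_compact_priestley.
- by apply: closed_compact_priestley; exact: open_closedC.
- move=> x y Ux nUy.
  have /existsNP[a /not_implyP[xa nya]] : ~ ((x : set A) `<=` (y : set A)).
    by move=> /primeFilter_leP xy; apply: nUy; exact: uU xy Ux.
  by exists (basic_upset a); split=> //; exists a.
exists a; apply: clopenUpset_ext; apply/seteqP; split=> // x ax.
by apply: contrapT => nUx; exact: UL nUx ax.
Qed.

End DLUnit.

(** * Inverses of the units, double duals and the equivalence *)

(** This lemma and the next make the inverses of the unit isomorphisms arrows of the two
    categories. *)
Lemma is_DLrel_lower_star d d' (A : tbDistrLatticeType d)
    (B : tbDistrLatticeType d') (g : dlMorphism A B) :
  is_DLrel (lower_star g).
Proof.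
split.
- move=> a' a b b' a'a ab bb'; apply: le_trans (le_trans ab bb').
  exact: omorph_le.
- by rewrite /lower_star/= omorph0.
- exact: lex1.
- by move=> a b a' b'; rewrite /lower_star/= omorphI; exact: leI2.
- by move=> a b a' b'; rewrite /lower_star/= omorphU; exact: leU2.
Qed.

Lemma is_Prirel_upper_star d d' (X : priestleyType d) (Y : priestleyType d')
    (f : priMorphism X Y) :
  is_Prirel (upper_star f).
Proof.
split.
  move=> y' y x x' y'y yx xx'; apply: le_trans y'y (le_trans yx _).
  exact: omorph_le.
rewrite -openC openE => -[y x] /= nyx.
have [U [[oU cU] uU Uy Ux]] := priestley_separation _ _ nyx.
exists (U, f @^-1` ~` U); first split => /=.
- exact: open_nbhs_nbhs.
- apply: (cts_fun (s := f)); apply: open_nbhs_nbhs; split=> //.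
  exact: closed_openC.
by move=> [y' x'] [/= Uy' nUx'] yx'; apply: nUx'; exact: uU yx' Uy'.
Qed.

(** Once [pri_unit] is unfolded, the left side is exactly the hypothesis of
    [bar_two_Pri_separation]. *)
Lemma bar_two_Pri_unit d d' (X : priestleyType d) (Y : priestleyType d')
    (r : set (X * Y)) : is_Prirel r -> forall x y,
  bar_two_DL (bar_two_Pri r) (pri_unit x, pri_unit y) <-> r (x, y).
Proof.
move=> Pr x y; split=> [H|rxy a b ab ax]; last exact: ab rxy ax.
exact: bar_two_Pri_separation Pr H.
Qed.

Lemma bar_two_DL_unit d d' (A : tbDistrLatticeType d)
    (B : tbDistrLatticeType d') (R : set (A * B)) : is_DLrel R -> forall a b,
  bar_two_Pri (bar_two_DL R) (dl_unit a, dl_unit b) <-> R (a, b).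
Proof.
move=> DR a b; split=> [H|Rab x y xy xa]; last exact: xy Rab xa.
exact: bar_two_DL_separation DR H.
Qed.

Theorem theorem5p9 :
  exists (wdPri : forall (X Y : Priob) (r : Prirel X Y),
            is_DLrel (bar_two_Pri r))
         (wdDL : forall (A B : DLob) (R : DLrel A B),
            is_Prirel (bar_two_DL R))
         (funPri : is_functor (C := co RelPri) (D := RelDL) (F0 := two_Pri)
            (fun (X Y : Priob) (r : Prirel X Y) => DLRel (wdPri X Y r)))
         (funDL : is_functor (C := RelDL) (D := co RelPri) (F0 := two_DL)
            (fun (A B : DLob) (R : DLrel A B) => PriRel (wdDL A B R))),
    let F : functor (co RelPri) RelDL := Functor funPri in
    let G : functor RelDL (co RelPri) := Functor funDL in
    [/\ forall (X Y : Priob) (r : Prirel X Y)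
            (a : clopenUpset X) (b : clopenUpset Y),
          bar_two_Pri r (a, b) <->
          [set z : set_type r | (a : set X) (set_val z).1] `<=`
          [set z : set_type r | (b : set Y) (set_val z).2],
        forall (X Y : Priob) (f : priMorphism X Y),
          fmap_hom F (Prirel_lower_star f : @hom (co RelPri) X Y) =
          DLrel_upper_star (dualPri f),
        forall (A B : DLob) (g : dlMorphism A B),
          fmap_hom G (DLrel_upper_star g : @hom RelDL B A) =
          Prirel_lower_star (dualDL g)
      & is_equivalence F G].
Proof.
exists (fun X Y r => is_DLrel_bar_two_Pri r).
exists (fun A B R => is_Prirel_bar_two_DL R).
unshelve eexists.
  split=> [X|X Y Z r s|X Y r s rs].
  - by apply: DLrel_inj; exact: bar_two_Pri_id.
  - by apply: DLrel_inj; apply: bar_two_Pri_comp; exact: PrirelP.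
  (* In [co RelPri], [rs] is the inclusion of [s] in [r]. *)
  - by move=> [a b] ab x y sxy; apply: ab; exact: rs.
unshelve eexists.
  split=> [A|A B C R S|A B R S RS].
  - by apply: Prirel_inj; exact: bar_two_DL_id.
  - by apply: Prirel_inj; apply: bar_two_DL_comp; exact: DLrelP.
  - by move=> [x y] xy a b Rab; apply: xy; exact: RS.
split.
- move=> X Y r a b; split=> [ab [[x y] rxy] /= |ab x y rxy].
    by apply: ab; exact: set_mem rxy.
  exact: (ab (exist _ (x, y) (mem_set rxy))).
- by move=> X Y f; apply: DLrel_inj; exact: bar_two_Pri_lower_star.
- by move=> A B g; apply: Prirel_inj; exact: bar_two_DL_upper_star.
split.
- exists (fun X : Priob => Prirel_lower_star (@pri_unit _ X)).
  exists (fun X : Priob => PriRel (is_Prirel_upper_star (@pri_unit _ X))).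
  split=> [X|X|X Y r]; apply: Prirel_inj.
  + exact: rel_comp_lower_upper_star pri_unit_mono.
  + exact: rel_comp_upper_lower_star pri_unit_surj.
  + apply: rel_comp_lower_star_natural.
    * exact: pri_unit_surj.
    * by have [] := is_Prirel_bar_two_DL (bar_two_Pri r).
    * by apply: bar_two_Pri_unit; exact: PrirelP.
(* On lattices the isomorphism runs from the double dual to the identity, so the upper star comes
   first. *)
- exists (fun A : DLob => DLrel_upper_star (@dl_unit _ A)).
  exists (fun A : DLob => DLRel (is_DLrel_lower_star (@dl_unit _ A))).
  split=> [A|A|A B R]; apply: DLrel_inj.
  + exact: rel_comp_upper_lower_star dl_unit_surj.
  + exact: rel_comp_lower_upper_star dl_unit_mono.
  + apply: rel_comp_upper_star_natural.
    * exact: dl_unit_surj.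
    * by have [] := is_DLrel_bar_two_Pri (bar_two_DL R).
    * by apply: bar_two_DL_unit; exact: DLrelP.
Qed.
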